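(* Let $D\in\mathcal E^n$ have embedding dimension $r$. Let $\bar k_1,\bar k_2,\bar k_3$ be nonnegative integers and define $$\alpha_1:=1\!:\!(\bar k_1+\bar k_2),\quad \alpha_2:=(\bar k_1+1)\!:\!(\bar k_1+\bar k_2+\bar k_3)\subseteq 1\!:\!n,$$ $$k_1:=|\alpha_1|=\bar k_1+\bar k_2,\quad k_2:=|\alpha_2|=\bar k_2+\bar k_3,\quad k:=\bar k_1+\bar k_2+\bar k_3.$$ For $i=1,2$, let $D[\alpha_i]\in\mathcal E^{k_i}$ have embedding dimension $r$, let $\mathcal K^\dagger(D[\alpha_i])=\bar U_iS_i\bar U_i^T$, where $\bar U_i\in\mathcal M^{k_i\times r}$, $\bar U_i^T\bar U_i=I_r$, $S_i\in\mathcal S^{r}_{++}$, and let $U_i:=\begin{bmatrix}\bar U_i&\frac1{\sqrt{k_i}}e\end{bmatrix}\in\mathcal M^{k_i\times(r+1)}$; thus $U_i^TU_i=I$ and $U_ie_{r+1}=\frac{1}{\sqrt{k_i}}e$. Partition $$U_1=\begin{bmatrix}U_1'\\ U_1''\end{bmatrix},\qquad U_2=\begin{bmatrix}U_2''\\ U_2'\end{bmatrix},$$ where $U_1''$ and $U_2''$ each consist of the $\bar k_2$ rows corresponding to $\alpha_1\cap\alpha_2$. Suppose that $U_1''$ and $U_2''$ have rank $r$ and $\mathcal R(U_1'')=\mathcal R(U_2'')$, and let $0\ne u_i\in\mathcal N(U_i'')$ for $i=1,2$. Let $t=r+1$ and let $\bar U\in\mathcal M^{k\times(t+1)}$ satisfy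 $\bar U^T\bar U=I_{t+1}$ and have as its range $$\mathcal R(\bar U)=\mathcal R\left(\begin{bmatrix}U_1'&0\\ U_1''&0\\ U_2'(U_2'')^\dagger U_1''&U_2'u_2\end{bmatrix}\right)=\mathcal R\left(\begin{bmatrix}U_1'(U_1'')^\dagger U_2''&U_1'u_1\\ U_2''&0\\ U_2'&0\end{bmatrix}\right)=\mathcal R\left(\begin{bmatrix}U_1&0\\0&I_{\bar k_3}\end{bmatrix}\right)\cap\mathcal R\left(\begin{bmatrix}I_{\bar k_1}&0\\0&U_2\end{bmatrix}\right).$$ Let $\begin{bmatrix}\bar V&\frac{\bar U^Te}{\|\bar U^Te\|}\end{bmatrix}\in\mathcal M^{t+1}$ be orthogonal. Let $\beta\subseteq\alpha_1\cap\alpha_2$ and, for $i=1,2$, let $\beta\subset\delta_i\subseteq\alpha_i$, $A_i:=J\bar U_{\delta_i}\bar V$, where $\bar U_{\delta_i}:=\bar U[\delta_i,:]$, and $B_i:=\mathcal K^\dagger(D[\delta_i])$. Consider the linear system $$A_1ZA_1^T=B_1,\qquad A_2ZA_2^T=B_2, \qquad ( * )$$ and let $\bar Z\in\mathcal S^t$ be a particular solution of $( * )$. If the embedding dimensions of $D[\delta_1]$ and $D[\delta_2]$ are both $r$, but the embedding dimension of $\bar D:=D[\beta]$ is $r-1$, then the following holds. 1. $\dim\mathcal N(A_i)=1$, for $i=1,2$. 2. For $i=1,2$, let $n_i\in\mathcal N(A_i)$, $\|n_i\|_2=1$, and let $\Delta Z:=n_1n_2^T+n_2n_1^T$. Then $Z\in\mathcal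 S^t$ is a solution of the linear system $( * )$ if and only if $Z=\bar Z+\tau\,\Delta Z$ for some $\tau\in\mathbb R$. 3. There are at most two nonzero solutions, $\tau_1$ and $\tau_2$, for the generalized eigenvalue problem $-\Delta Z\,v=\tau\bar Z v$, $v\ne0$. Set $Z_i:=\bar Z+\frac1{\tau_i}\Delta Z$, for $i=1,2$. Then $$D[\alpha_1\cup\alpha_2]\in\left\{\mathcal K\left(\bar U\bar VZ_i\bar V^T\bar U^T\right):i=1,2\right\}.$$
   Context: Notation. $\mathcal S^n$ is the space of real symmetric $n\times n$ matrices; $\mathcal S^n_{++}$ denotes the positive definite ones. $\mathcal M^{p\times q}$ is the space of real $p\times q$ matrices and $\mathcal M^p=\mathcal M^{p\times p}$. $\mathcal R(\cdot)$ and $\mathcal N(\cdot)$ denote range (column space) and null space and, for a matrix $A$, $A^\dagger$ is the Moore–Penrose generalized inverse. $e$ is the all-ones vector of appropriate dimension, $e_{r+1}$ is the last standard unit vector of $\mathbb R^{r+1}$, and $a\!:\!b=\{a,a+1,\dots,b\}$. For an index set $\alpha$, $Y[\alpha]$ is the principal submatrix of $Y$ with rows and columns indexed by $\alpha$, and $\bar U[\delta,:]$ is the submatrix of $\bar U$ formed by the rows indexed by $\delta$ (the rows of $\bar U$ being indexed by $1\!:\!k=\alpha_1\cup\alpha_2$). $J=I-\frac1m ee^T$ is the orthogonal projection onto $\{e\}^\perp$ in $\mathbb R^m$, of the appropriate order $m$ (here $m=|\delta_i|$ in $A_i$). Euclidean distance matrices. $D\in\mathcal S^n$ is a Euclidean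 distance matrix (EDM) if there are an integer $r\ge0$ and points $p_1,\dots,p_n\in\mathbb R^r$ with $D_{ij}=\|p_i-p_j\|_2^2$ for all $i,j$ (squared distances); the smallest such $r$ is the embedding dimension of $D$. $\mathcal E^n\subset\mathcal S^n$ is the cone of $n\times n$ EDMs. Operators. $\mathcal K:\mathcal S^n\to\mathcal S^n$ is $\mathcal K(Y)=\operatorname{diag}(Y)e^T+e\operatorname{diag}(Y)^T-2Y$, where $\operatorname{diag}(Y)$ is the vector of diagonal entries of $Y$. Its Moore–Penrose generalized inverse is $\mathcal K^\dagger(D)=-\frac12J\,\mathrm{offDiag}(D)\,J$, where $\mathrm{offDiag}(D)$ is $D$ with its diagonal replaced by zeros. The same symbols are used for matrices of any order (with $n$ replaced by the order).
   Formalization: In part 3, when Z̄ is singular, τ=∞ also counts as a nonzero generalized eigenvalue, with 1/τ=0 (so Z_i=Z̄); with finite τ only, the claim fails when Z̄ itself already yields D[α1∪α2]. The assumption r≥1, implicit in ''r−1'', is explicit. *)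

(* Defs.v *)
From HB Require Import structures.
From mathcomp Require Import all_boot all_order all_algebra.
From mathcomp Require Import reals.
Set Implicit Arguments.
Unset Strict Implicit.
Unset Printing Implicit Defensive.
Import Order.TTheory GRing.Theory Num.Theory.
Local Open Scope ring_scope.

(* Vectors of R^m are column vectors.  Ranges (column spaces) are compared
   through row spaces of transposes: R(A) = R(B) is (A^T == B^T)%MS, and
   R(A) :&: R(B) is (A^T :&: B^T)%MS. *)

Definition ones (R : realType) (m : nat) : 'cV[R]_m := const_mx 1.
Arguments ones {R m}.

Definition norm2 (R : realType) (m : nat) (v : 'cV[R]_m) : R :=
  Num.sqrt (\sum_i v i 0 ^+ 2).

Definition symm (R : realType) (m : nat) (A : 'M[R]_m) : Prop := A^T = A.

Definition posdef (R : realType) (m : nat) (A : 'M[R]_m) : Prop :=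
  symm A /\ forall x : 'cV[R]_m, x != 0 -> 0 < (x^T *m A *m x) 0 0.

Definition centering (R : realType) (m : nat) : 'M[R]_m :=
  1%:M - m%:R^-1 *: (ones *m ones^T).
Arguments centering {R m}.

Definition EDM_in_dim (R : realType) (n : nat) (D : 'M[R]_n) (r : nat) : Prop :=
  exists p : 'I_n -> 'cV[R]_r, forall i j, D i j = norm2 (p i - p j) ^+ 2.

Definition EDM_embdim (R : realType) (n : nat) (D : 'M[R]_n) (r : nat) : Prop :=
  EDM_in_dim D r /\ forall s, EDM_in_dim D s -> (r <= s)%N.

Definition diagv (R : realType) (m : nat) (Y : 'M[R]_m) : 'cV[R]_m :=
  \col_i Y i i.

Definition opK (R : realType) (m : nat) (Y : 'M[R]_m) : 'M[R]_m :=
  diagv Y *m ones^T + ones *m (diagv Y)^T - 2 *: Y.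

Definition offDiag (R : realType) (m : nat) (D : 'M[R]_m) : 'M[R]_m :=
  \matrix_(i, j) (if i == j then 0 else D i j).

Definition opKdag (R : realType) (m : nat) (D : 'M[R]_m) : 'M[R]_m :=
  - 2^-1 *: (centering *m offDiag D *m centering).

(* enum_val lists a set of ordinals in increasing order. *)
Definition psub (R : realType) (n : nat) (D : 'M[R]_n) (a : {set 'I_n}) :
  'M[R]_#|a| := mxsub enum_val enum_val D.

Definition rowsOf (R : realType) (m n : nat) (A : 'M[R]_(m, n))
  (a : {set 'I_m}) : 'M[R]_(#|a|, n) := rowsub enum_val A.

Definition is_mpinv (R : realType) (m n : nat) (A : 'M[R]_(m, n))
    (X : 'M[R]_(n, m)) : Prop :=
  [/\ A *m X *m A = A, X *m A *m X = X,
      (A *m X)^T = A *m X & (X *m A)^T = X *m A].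

(* Full-rank factorization A = C F gives F^T (F F^T)^-1 (C^T C)^-1 C^T. *)
Definition mpinv (R : realType) (m n : nat) (A : 'M[R]_(m, n)) : 'M[R]_(n, m) :=
  let C := col_base A in let F := row_base A in
  F^T *m invmx (F *m F^T) *m invmx (C^T *m C) *m C^T.

Lemma gram_unit (R : realType) (m n : nat) (F : 'M[R]_(m, n)) :
  row_free F -> F *m F^T \in unitmx.
Proof.
move=> Ff; rewrite -row_free_unit -kermx_eq0; apply/eqP/row_matrixP=> i.
rewrite row0; set x := row i _.
have h : x *m (F *m F^T) = 0 by rewrite /x -row_mul mulmx_ker row0.
have h0 : (x *m F) *m (x *m F)^T = 0.
  by rewrite trmx_mul mulmxA -(mulmxA x) h mul0mx.
suff y0 : x *m F = 0 by apply: (row_free_inj Ff); rewrite y0 mul0mx.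
move: (x *m F) h0 => y /matrixP /(_ 0 0); rewrite !mxE => h0.
apply/rowP=> j; rewrite mxE.
have s0 : \sum_k y 0 k ^+ 2 = 0.
  by rewrite -[RHS]h0; apply: eq_bigr => k _; rewrite mxE expr2.
have /(_ j isT) /eqP := psumr_eq0P (fun k _ => sqr_ge0 (y 0 k)) s0.
by rewrite sqrf_eq0 => /eqP.
Qed.

Lemma mpinvP (R : realType) (m n : nat) (A : 'M[R]_(m, n)) :
  is_mpinv A (mpinv A).
Proof.
rewrite /mpinv; have := mulmx_base A.
have := row_base_free A; have := col_base_full A.
move: (row_base A) (col_base A) => F C Cf Ff /= E.
have uF := gram_unit Ff.
have uC : C^T *m C \in unitmx.
  have := @gram_unit R _ _ C^T; rewrite trmxK; apply.
  by rewrite -row_leq_rank mxrank_tr col_leq_rank.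
set P := invmx (F *m F^T); set Q := invmx (C^T *m C).
have PT : P^T = P by rewrite /P trmx_inv trmx_mul trmxK.
have QT : Q^T = Q by rewrite /Q trmx_inv trmx_mul trmxK.
have AX : A *m (F^T *m P *m Q *m C^T) = C *m Q *m C^T.
  by rewrite -[X in X *m _]E !mulmxA -(mulmxA C F) /P mulmxK.
have XA : F^T *m P *m Q *m C^T *m A = F^T *m P *m F.
  by rewrite -[X in _ *m X]E !mulmxA -(mulmxA _ C^T) /Q mulmxKV.
split.
- by rewrite AX -[X in _ *m X]E mulmxA -(mulmxA _ C^T) /Q mulmxKV // E.
- by rewrite XA !mulmxA -(mulmxA _ F F^T) /P mulmxKV.
- by rewrite AX !trmx_mul trmxK QT mulmxA.
- by rewrite XA !trmx_mul trmxK PT mulmxA.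
Qed.

Lemma mpinv_unique (R : realType) (m n : nat) (A : 'M[R]_(m, n)) X Y :
  is_mpinv A X -> is_mpinv A Y -> X = Y.
Proof.
case=> X1 X2 X3 X4 [Y1 Y2 Y3 Y4].
have a : A *m X = A *m Y.
  by rewrite -X3 -{1}Y1 -mulmxA trmx_mul X3 Y3 mulmxA X1.
have b : X *m A = Y *m A.
  by rewrite -X4 -{1}Y1 !mulmxA -(mulmxA (X *m A)) trmx_mul X4 Y4 -!mulmxA
             (mulmxA A X A) X1.
by rewrite -X2 b -mulmxA a mulmxA Y2.
Qed.

(* [ Ubar  e / sqrt k ] *)
Definition extU (R : realType) (k r : nat) (Ub : 'M[R]_(k, r)) :
  'M[R]_(k, r + 1) := row_mx Ub ((Num.sqrt k%:R)^-1 *: ones).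

Definition col_mx3 (R : realType) (m1 m2 m3 n : nat) (A1 : 'M[R]_(m1, n))
    (A2 : 'M[R]_(m2, n)) (A3 : 'M[R]_(m3, n)) : 'M[R]_(m1 + m2 + m3, n) :=
  col_mx (col_mx A1 A2) A3.

(* alpha1 = 1:(k1+k2) and alpha2 = (k1+1):(k1+k2+k3), 0-based, inside the
   union 1:(k1+k2+k3), together with their increasing enumerations. *)
Definition alpha1 (k1 k2 k3 : nat) : {set 'I_(k1 + k2 + k3)} :=
  [set i : 'I_(k1 + k2 + k3) | (i < k1 + k2)%N].
Definition alpha2 (k1 k2 k3 : nat) : {set 'I_(k1 + k2 + k3)} :=
  [set i : 'I_(k1 + k2 + k3) | (k1 <= i)%N].
Definition ord_alpha1 (k1 k2 k3 : nat) (i : 'I_(k1 + k2)) :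
  'I_(k1 + k2 + k3) := lshift k3 i.
Definition ord_alpha2 (k1 k2 k3 : nat) (i : 'I_(k2 + k3)) :
  'I_(k1 + k2 + k3) := cast_ord (addnA k1 k2 k3) (rshift k1 i).
Arguments ord_alpha1 {k1 k2} k3 i.
Arguments ord_alpha2 k1 {k2 k3} i.

(* Solutions tau in R \cup {oo} of A v = tau B v, v <> 0.  As usual for matrix
   pencils, oo (encoded None) is a generalized eigenvalue when B is singular;
   its reciprocal is 0. *)
Definition gen_eigenvalue (R : realType) (m : nat) (A B : 'M[R]_m)
    (tau : option R) : Prop :=
  exists2 v : 'cV[R]_m, v != 0 &
    if tau is Some x then A *m v = x *: (B *m v) else B *m v = 0.

Definition recip (R : realType) (tau : option R) : R :=
  if tau is Some x then x^-1 else 0.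

(* Main.v *)
Require Import Defs.
From mathcomp Require Import all_boot all_order all_algebra.
From mathcomp Require Import reals.
From mathcomp Require Import ring lra.
Import Order.TTheory GRing.Theory Num.Theory.
Local Open Scope ring_scope.

(** Let the rows of P be points that realize D[alpha1 :|: alpha2] in dimension
r.  The columns of the matrices U1, U2, Ub are functions on the points.  The
range of U_i consists of the restrictions to alpha_i of the affine functions of
the points ([extU_affine_range]): both spaces have dimension r + 1, because a
clique of embedding dimension r affinely spans the space ([embdim_row_full]).
Hence the range of Ub, the intersection of the two extended ranges, contains
all affine functions and consists of functions that are affine on each clique
([overlap_range]).

Centering the rows of Ub in delta_i therefore leaves the linear parts of affine
functions, so A_i has rank r and its kernel is a line, spanned by a function
that is constant on alpha_i ([rank_centered], [ker_centered_const]).  The two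
lines differ: a function constant on both cliques is constant, since they
overlap, and Ub Vb represents no nonzero constant function.

Since the range of Ub contains the columns of P and ones, P = Ub Vb X + ones c
for some X and some translation c.  Then A_i X is the centered configuration of
delta_i, so Z0 = X X^T solves the system and opK recovers D[alpha1 :|: alpha2]
from it.  The difference of two solutions is a symmetric form that vanishes on
the hyperplanes orthogonal to n1 and to n2, hence a multiple of dZ
([sym_vanish_on_two_hyperplanes]).

Finally Z0 = Zb + tau0 dZ is singular, having rank r and order r + 1.  So its
parameter is a root of the determinant of Zb + s dZ, that is, the reciprocal of
a generalized eigenvalue ([gen_eigenvalue_root]).  The kernel of X^T is not
orthogonal to n1 or n2, for otherwise n_i would be X x, on which A_i does not
vanish.  This transversality leaves room for only one root besides tau0
([pencil_nonzero_root_unique]). *)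

Set Implicit Arguments.
Unset Strict Implicit.
Unset Printing Implicit Defensive.

(** * Ranges and kernels of matrices *)

Lemma inj_row_full (F : fieldType) (m n : nat) (A : 'M[F]_(m, n)) :
  (forall x : 'cV_n, A *m x = 0 -> x = 0) -> row_full A.
Proof.
move=> inj; rewrite /row_full -mxrank_tr -/(row_free A^T) -kermx_eq0.
apply/eqP/row_matrixP => i; rewrite row0.
apply: trmx_inj; rewrite trmx0; apply: inj.
by apply: trmx_inj; rewrite trmx_mul trmxK trmx0 -row_mul mulmx_ker row0.
Qed.

Lemma row_full_eq0 (F : fieldType) (m n p : nat) (A : 'M[F]_(m, n))
    (B : 'M_(n, p)) : row_full A -> A *m B = 0 -> B = 0.
Proof. by move=> fA AB; apply: (row_full_inj fA); rewrite mulmx0. Qed.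

Lemma col_rangeP (F : fieldType) (m n p : nat) (A : 'M[F]_(m, n))
    (B : 'M_(m, p)) :
  reflect (exists C, B = A *m C) (B^T <= A^T)%MS.
Proof.
apply: (iffP submxP) => [[C]|[C ->]].
  by move=> /(congr1 trmx); rewrite trmx_mul !trmxK => ->; exists C^T.
by exists C^T; rewrite trmx_mul.
Qed.

Lemma left_null_vector (F : fieldType) r (X : 'M[F]_(r + 1, r)) :
  row_full X -> exists2 v : 'cV_(r + 1), v != 0 & X^T *m v = 0.
Proof.
move=> fX; have : kermx X != 0 by rewrite -mxrank_eq0 mxrank_ker (eqP fX) addKn.
case/rowV0Pn => v /sub_kermxP vX v0; exists v^T; first by rewrite trmx_eq0.
by rewrite -trmx_mul vX trmx0.
Qed.

(** When the kernel of A is the line spanned by n, the row space of A is the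
whole hyperplane of covectors that vanish at n. *)
Lemma sub_rowspace_ker_line (F : fieldType) (m p t : nat) (A : 'M[F]_(m, t + 1))
    (B : 'M_(p, t + 1)) (n : 'cV_(t + 1)) :
  \rank A = t -> n != 0 -> A *m n = 0 -> B *m n = 0 -> (B <= A)%MS.
Proof.
move=> rA n0 /sub_kermxP sA /sub_kermxP sB.
apply: (submx_trans sB); rewrite -(geq_leqif (mxrank_leqif_sup sA)) rA mxrank_ker.
have : (0 < \rank n)%N by rewrite lt0n mxrank_eq0.
by move: (\rank n) => [|q] // _; rewrite leq_subLR addSn addn1 ltnS leq_addl.
Qed.

(** * Inner products and centering *)

Lemma dot_selfE (R : realType) m (v : 'cV[R]_m) : v^T *m v = (norm2 v ^+ 2)%:M.
Proof.
rewrite [LHS]mx11_scalar /norm2 sqr_sqrtr ?sumr_ge0 // => [|i _]; last exact: sqr_ge0.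
by congr (_%:M); rewrite mxE; apply: eq_bigr => i _; rewrite mxE expr2.
Qed.

Lemma dot_self_eq0 (R : realType) m (v : 'cV[R]_m) : v^T *m v = 0 -> v = 0.
Proof.
move=> /matrixP /(_ 0 0); rewrite !mxE => h; apply/colP => i; rewrite mxE.
have s0 : \sum_k v k 0 ^+ 2 = 0.
  by rewrite -[RHS]h; apply: eq_bigr => k _; rewrite mxE expr2.
have /(_ i isT) /eqP := psumr_eq0P (fun k _ => sqr_ge0 (v k 0)) s0.
by rewrite sqrf_eq0 => /eqP.
Qed.

Lemma dot1_neq0 (R : realType) m (v : 'cV[R]_m) : v^T *m v = 1%:M -> v != 0.
Proof.
move=> vv; apply/eqP => v0; move/matrixP/(_ 0 0): vv.
by rewrite v0 mulmx0 !mxE => /eqP; rewrite eq_sym oner_eq0.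
Qed.

Lemma gram_eq0 (R : realType) m n (B : 'M[R]_(m, n)) : B *m B^T = 0 -> B = 0.
Proof.
move=> h; apply/row_matrixP => i; rewrite row0; apply: trmx_inj; rewrite trmx0.
by apply: dot_self_eq0; rewrite trmxK tr_row colE mulmxA -row_mul h row0 mul0mx.
Qed.

Lemma centering_ones (R : realType) m : centering *m ones = 0 :> 'cV[R]_m.
Proof.
case: m => [|m]; first by apply/matrixP => -[].
rewrite /centering mulmxBl mul1mx -scalemxAl -mulmxA.
have -> : (ones : 'cV[R]_m.+1)^T *m ones = m.+1%:R%:M.
  apply/matrixP => i j; rewrite !ord1 !mxE eqxx mulr1n.
  by under eq_bigr do rewrite !mxE mulr1; rewrite sumr_const card_ord.
by rewrite mul_mx_scalar scalerA mulVf ?pnatr_eq0 // scale1r subrr.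
Qed.

Lemma centering_tr (R : realType) m : (centering : 'M[R]_m)^T = centering.
Proof. by rewrite /centering linearB /= linearZ /= trmx1 trmx_mul trmxK. Qed.

(** The second term has all its rows equal to the centroid of the rows of B. *)
Lemma centeringE (R : realType) m p (B : 'M[R]_(m, p)) :
  B = centering *m B + ones *m (m%:R^-1 *: (ones^T *m B)).
Proof. by rewrite /centering mulmxBl mul1mx -scalemxAl -scalemxAr mulmxA subrK. Qed.

(** * Distance matrices as Gram matrices *)

Lemma opK_gramE (R : realType) m r (P : 'M[R]_(m, r)) i j :
  opK (P *m P^T) i j = \sum_l (P i l - P j l) ^+ 2.
Proof.
rewrite /opK !mxE !big_ord1 !mxE mulr1 mul1r mulr_sumr -big_split -sumrB /=.
by apply: eq_bigr => l _; rewrite !mxE; ring.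
Qed.

Lemma opK_gram_translate (R : realType) m r (P : 'M[R]_(m, r)) (c : 'rV_r) :
  opK ((P + ones *m c) *m (P + ones *m c)^T) = opK (P *m P^T).
Proof.
apply/matrixP => i j; rewrite !opK_gramE; apply: eq_bigr => l _.
by rewrite !mxE !big_ord1 !mxE; ring.
Qed.

Lemma mxsub_opK (R : realType) m m' r (f : 'I_m' -> 'I_m) (P : 'M[R]_(m, r)) :
  mxsub f f (opK (P *m P^T)) = opK (rowsub f P *m (rowsub f P)^T).
Proof.
apply/matrixP => i j; rewrite mxE !opK_gramE; apply: eq_bigr => l _.
by rewrite !mxE.
Qed.

(** The diagonal of opK Y is zero, so offDiag keeps the whole matrix, and
centering kills the two rank-one terms of opK Y, which have a factor ones. *)
Lemma opKdag_opK (R : realType) m r (P : 'M[R]_(m, r)) :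
  opKdag (opK (P *m P^T)) = (centering *m P) *m (centering *m P)^T.
Proof.
have -> : opKdag (opK (P *m P^T)) =
    - 2^-1 *: (centering *m opK (P *m P^T) *m centering).
  congr (_ *: (_ *m _ *m _)); apply/matrixP => i j; rewrite mxE.
  case: eqP => // ->; rewrite opK_gramE big1 // => l _.
  by rewrite subrr expr0n.
have onesC : ones^T *m (centering : 'M[R]_m) = 0.
  by rewrite -[X in _ *m X]centering_tr -trmx_mul centering_ones trmx0.
have := centering_ones R m; have := centering_tr R m.
move: centering onesC => J onesC JT J1.
rewrite /opK mulmxBr mulmxDr !(mulmxA J) J1 mul0mx addr0 mulmxBl.
rewrite -(mulmxA _ ones^T) onesC mulmx0 sub0r -scalemxAr -scalemxAl scalerN.
rewrite scaleNr opprK scalerA mulVf ?pnatr_eq0 // scale1r trmx_mul JT.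
by rewrite !mulmxA.
Qed.

Lemma EDM_gram (R : realType) n r (D : 'M[R]_n) :
  EDM_in_dim D r <-> exists P : 'M[R]_(n, r), D = opK (P *m P^T).
Proof.
split=> [[p Dp]|[P ->]].
  exists (\matrix_(i, l) p i l 0); apply/matrixP => i j.
  rewrite opK_gramE Dp /norm2 sqr_sqrtr ?sumr_ge0 // => [|l _]; last exact: sqr_ge0.
  by apply: eq_bigr => l _; rewrite !mxE.
exists (fun i => (row i P)^T) => i j.
rewrite opK_gramE /norm2 sqr_sqrtr ?sumr_ge0 // => [|l _]; last exact: sqr_ge0.
by apply: eq_bigr => l _; rewrite !mxE.
Qed.

(** The Householder reflection that sends x to a multiple of the first unit
vector maps the orthogonal complement of x isometrically onto the vectors whose
first coordinate is zero, so that coordinate can be dropped. *)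
Lemma isometry_orthogonal (R : realType) r (x : 'cV[R]_r.+1) : x != 0 ->
  exists T : 'M[R]_(r.+1, r), forall y : 'rV_r.+1, y *m x = 0 ->
    \sum_l (y *m T) 0 l ^+ 2 = \sum_l y 0 l ^+ 2.
Proof.
move=> x0.
have sE : norm2 x ^+ 2 = x ord0 0 ^+ 2 + \sum_(l < r) x (lift ord0 l) 0 ^+ 2.
  by rewrite /norm2 sqr_sqrtr ?sumr_ge0 ?big_ord_recl // => l _; exact: sqr_ge0.
have s0 : norm2 x != 0.
  apply: contraNneq x0 => h; apply/eqP/dot_self_eq0.
  by rewrite dot_selfE h expr0n; exact: raddf0.
(* one of the signs s = |x|, s = -|x| makes the reflection along x + s e_0
   well defined *)
have [s [s2 sx]] : exists s, s ^+ 2 = norm2 x ^+ 2 /\ s + x ord0 0 != 0.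
  have [h|h] := eqVneq (norm2 x + x ord0 0) 0; last by exists (norm2 x).
  exists (- norm2 x); split; first exact: sqrrN.
  by apply: contraNneq s0 => h'; apply/eqP; lra.
pose T : 'M[R]_(r.+1, r) := \matrix_(i, l)
  ((i == lift ord0 l)%:R - (i == ord0)%:R * (x (lift ord0 l) 0 / (s + x ord0 0))).
(* yx expresses the cross terms of the squares through x_0 y_0 *)
exists T => y; move=> /matrixP /(_ 0 0); rewrite !mxE big_ord_recl => yx.
have yT l : (y *m T) 0 l = y 0 (lift ord0 l) - y 0 ord0 / (s + x ord0 0) * x (lift ord0 l) 0.
  rewrite mxE; under eq_bigr do rewrite mxE mulrBr.
  rewrite sumrB (bigD1 (lift ord0 l)) //= eqxx mulr1 big1 => [|i /negPf ->]; last by rewrite mulr0.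
  rewrite (bigD1 ord0) //= mul1r big1 => [|i /negPf ->]; last by rewrite mul0r mulr0.
  by ring.
under eq_bigr do rewrite yT sqrrB exprMn.
rewrite big_split sumrB /= -mulr_sumr big_ord_recl.
have -> : \sum_(i < r) x (lift ord0 i) 0 ^+ 2 = s ^+ 2 - x ord0 0 ^+ 2 by rewrite s2 sE; ring.
have -> : \sum_(i < r) y 0 (lift ord0 i) * (y 0 ord0 / (s + x ord0 0) * x (lift ord0 i) 0) *+ 2
   = y 0 ord0 / (s + x ord0 0) * 2 * - (y 0 ord0 * x ord0 0).
  rewrite (addr0_eq yx) mulr_sumr; apply: eq_bigr => i _; rewrite -mulr_natr; ring.
by field.
Qed.

(** Points that realize a distance matrix in its embedding dimension affinely
span the space: if x annihilated the centered configuration, all the differences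
of points would be orthogonal to x, and dropping that direction by
[isometry_orthogonal] would give a realization in a smaller dimension. *)
Lemma embdim_row_full (R : realType) m r (P : 'M[R]_(m, r)) :
  EDM_embdim (opK (P *m P^T)) r -> row_full (centering *m P).
Proof.
move=> [_ minr]; apply: inj_row_full => x Px; apply/eqP/negPn/negP => x0.
case: r => [|r] in P x minr Px x0 *.
  by case/eqP: x0; apply/matrixP => -[].
have [T TE] := @isometry_orthogonal _ _ x x0.
suff /minr : EDM_in_dim (opK (P *m P^T)) r by rewrite ltnn.
apply/EDM_gram; exists (P *m T); apply/matrixP => i j; rewrite !opK_gramE.
transitivity (\sum_l (row i P - row j P) 0 l ^+ 2).
  by apply: eq_bigr => l _; rewrite !mxE.
rewrite -TE; first by apply: eq_bigr => l _; rewrite mulmxBl -!row_mul !mxE.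
rewrite mulmxBl -!row_mul (centeringE (P *m x)) mulmxA Px add0r.
by rewrite !row_mul -mulmxBl !row_const subrr mul0mx.
Qed.

(** * Affine functions of the points *)

Lemma row_full_affine (R : realType) m r (P : 'M[R]_(m, r)) :
  (0 < m)%N -> row_full (centering *m P) -> row_full (row_mx P ones).
Proof.
move=> m0 fP; apply: inj_row_full => x; rewrite -[x]vsubmxK mul_row_col => e.
have u0 : usubmx x = 0.
  apply: (row_full_eq0 fP).
  by rewrite -(mulmx0 _ centering) -e mulmxDr !mulmxA centering_ones mul0mx addr0.
move: e; rewrite u0 mulmx0 add0r => /matrixP /(_ (Ordinal m0) 0).
rewrite mxE big_ord1 mxE mul1r [RHS]mxE => d0.
by rewrite [dsubmx x]mx11_scalar d0 raddf0 col_mx0.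
Qed.

(** The factor extU U spans the affine functions of the points.  Indeed
U U^T fixes the centered configuration G, because (1 - U U^T) G has zero Gram
matrix; hence P and ones lie in the range of extU U, which has no more columns
than the full-rank matrix row_mx P ones. *)
Lemma extU_affine_range (R : realType) m r (P U : 'M[R]_(m, r)) (S : 'M_r) :
  (0 < m)%N -> row_full (centering *m P) ->
  U^T *m U = 1%:M -> opKdag (opK (P *m P^T)) = U *m S *m U^T ->
  exists2 M, M \in unitmx & row_mx P ones = extU U *m M.
Proof.
move=> m0 fP UU; rewrite opKdag_opK => PU.
set G := centering *m P in PU fP.
have GU : G = U *m (U^T *m G).
  apply/eqP; rewrite -subr_eq0; apply/eqP/gram_eq0.
  have NU : (1%:M - U *m U^T) *m U = 0 by rewrite mulmxBl mul1mx -mulmxA UU mulmx1 subrr.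
  have -> : G - U *m (U^T *m G) = (1%:M - U *m U^T) *m G by rewrite mulmxBl mul1mx mulmxA.
  by rewrite trmx_mul mulmxA -(mulmxA _ G) PU !mulmxA NU !mul0mx.
have s0 : Num.sqrt m%:R != 0 :> R by rewrite sqrtr_eq0 -ltNge ltr0n.
pose c := m%:R^-1 *: (ones^T *m P).
pose M := block_mx (U^T *m G) 0 (Num.sqrt m%:R *: c) (Num.sqrt m%:R)%:M : 'M[R]_(r + 1).
have QM : row_mx P ones = extU U *m M.
  rewrite /extU mul_row_block -GU mulmx0 add0r -!scalemxAl -scalemxAr scalerA.
  by rewrite mulVf // scale1r -centeringE mul_mx_scalar scalerA mulVf // scale1r.
exists M => //; rewrite -row_full_unit /row_full eqn_leq rank_leq_col /=.
by rewrite -{1}(eqP (row_full_affine m0 fP)) QM mxrankM_maxr.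
Qed.

Lemma rowsub_mul (F : fieldType) m m' n p (f : 'I_m' -> 'I_m)
  (A : 'M[F]_(m, n)) (B : 'M_(n, p)) : rowsub f (A *m B) = rowsub f A *m B.
Proof. by apply/matrixP => i j; rewrite !mxE; apply: eq_bigr => l _; rewrite mxE. Qed.

Lemma rowsub_ones (R : realType) m m' (f : 'I_m' -> 'I_m) :
  rowsub f (ones : 'cV[R]_m) = ones.
Proof. by apply/matrixP => i j; rewrite !mxE. Qed.

Lemma rowsub_row_mx (F : fieldType) m m' n p (f : 'I_m' -> 'I_m)
  (A : 'M[F]_(m, n)) (B : 'M_(m, p)) : rowsub f (row_mx A B) = row_mx (rowsub f A) (rowsub f B).
Proof. by apply/matrixP => i j; rewrite !mxE; case: split => l; rewrite mxE. Qed.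

(** The columns of U are functions on all the points; f enumerates a clique on
which each of them is affine in the points P, with coefficients C.  The subset
delta of the clique is large enough to span the space. *)
Section OneClique.

Variables (R : realType) (k m r q : nat) (P : 'M[R]_(k, r)) (U : 'M[R]_(k, q)).
Variables (V : 'M[R]_(q, r + 1)) (f : 'I_m -> 'I_k) (delta : {set 'I_k}).
Variables (C : 'M[R]_(r + 1, q)).
Hypothesis affU : rowsub f U = rowsub f (row_mx P ones) *m C.
Hypothesis sub_delta : forall i, i \in delta -> exists j, i = f j.
Let G := centering *m rowsOf P delta.
Let A := centering *m rowsOf U delta *m V.
Hypothesis fullG : row_full G.

(** Centering removes the constant term dsubmx C of the affine functions. *)
Lemma centered_rows : A = G *m (usubmx C *m V).
Proof.
rewrite /A mulmxA; congr (_ *m _).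
have -> : rowsOf U delta = row_mx (rowsOf P delta) ones *m C.
  apply/row_matrixP => i; rewrite row_mul.
  have [j Hj] := sub_delta (enum_valP i).
  have -> : row i (rowsOf U delta) = row j (rowsub f U) by apply/rowP => l; rewrite !mxE Hj.
  rewrite affU row_mul; congr (_ *m _).
  by apply/rowP => l; rewrite !mxE -Hj; case: split => l'; rewrite !mxE.
by rewrite -[in LHS](vsubmxK C) mul_row_col mulmxDr !mulmxA centering_ones mul0mx addr0.
Qed.

(** On the clique, U V n is an affine function; as it is constant on delta,
which spans the space, its linear part vanishes. *)
Lemma ker_centered_const (n : 'cV[R]_(r + 1)) : A *m n = 0 ->
  exists c, rowsub f (U *m V *m n) = const_mx c.
Proof.
rewrite centered_rows -mulmxA => /(row_full_eq0 fullG) e.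
exists ((dsubmx C *m V *m n) 0 0).
rewrite !rowsub_mul affU rowsub_row_mx rowsub_ones -[in LHS](vsubmxK C) mul_row_col.
rewrite !mulmxDl -!mulmxA (mulmxA (usubmx C)) e mulmx0 add0r (mulmxA (dsubmx C)).
by apply/matrixP => i j; rewrite !ord1 [LHS]mxE big_ord1 !mxE mul1r.
Qed.

(** Up to the translation c, the points have coordinates X in terms of U V. *)
Variables (X : 'M[R]_(r + 1, r)) (c : 'rV[R]_r).
Hypothesis PX : P = U *m V *m X + ones *m c.

Lemma centered_factor : A *m X = G.
Proof.
rewrite /A /G PX -!mulmxA.
have -> : rowsOf (U *m (V *m X) + ones *m c) delta = rowsOf U delta *m (V *m X) + ones *m c.
  by rewrite /rowsOf linearD /= !rowsub_mul rowsub_ones.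
by rewrite mulmxDr (mulmxA _ ones) centering_ones mul0mx addr0.
Qed.

Lemma rank_centered : \rank A = r.
Proof.
apply/eqP; rewrite eqn_leq; apply/andP; split.
  by rewrite centered_rows (leq_trans (mxrankM_maxl _ _)) ?rank_leq_col.
by rewrite -{1}(eqP fullG) -centered_factor mxrankM_maxl.
Qed.

End OneClique.

(** * Two overlapping cliques *)

Lemma rowsub_alpha1 (F : fieldType) k1 k2 k3 n (A : 'M[F]_(k1, n))
    (B : 'M_(k2, n)) (C : 'M_(k3, n)) :
  rowsub (ord_alpha1 k3) (col_mx (col_mx A B) C) = col_mx A B.
Proof. by apply/matrixP => i j; rewrite mxE /ord_alpha1 col_mxEu. Qed.

Lemma rowsub_alpha2 (F : fieldType) k1 k2 k3 n (A : 'M[F]_(k1, n))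
    (B : 'M_(k2, n)) (C : 'M_(k3, n)) :
  rowsub (ord_alpha2 k1) (col_mx (col_mx A B) C) = col_mx B C.
Proof.
apply/matrixP => i j; rewrite mxE; case: (splitP i) => l Hl.
  have -> : ord_alpha2 k1 i = lshift k3 (rshift k1 l) by apply: val_inj; rewrite /= Hl.
  have -> : i = lshift k3 l by apply: val_inj.
  by rewrite !(col_mxEu, col_mxEd).
have -> : ord_alpha2 k1 i = rshift (k1 + k2) l by apply: val_inj; rewrite /= Hl addnA.
have -> : i = rshift k2 l by apply: val_inj.
by rewrite !col_mxEd.
Qed.

(** The first factor of the intersection consists of the vectors whose
restriction to the first clique lies in the range of U1, the other entries being
free, and symmetrically for the second one. *)
Lemma overlap_range (R : realType) k1 k2 k3 p q1 q2 c (U : 'M[R]_(k1 + k2 + k3, p))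
    (U1 : 'M_(k1 + k2, q1)) (U2 : 'M_(k2 + k3, q2)) (Q : 'M_(k1 + k2 + k3, c))
    (M1 : 'M_(q1, c)) (M2 : 'M_(q2, c)) :
  (U^T == (col_mx3 (row_mx (usubmx U1) 0) (row_mx (dsubmx U1) 0) (row_mx 0 (1%:M : 'M_k3)))^T
     :&: (col_mx3 (row_mx (1%:M : 'M_k1) 0) (row_mx 0 (usubmx U2)) (row_mx 0 (dsubmx U2)))^T)%MS ->
  rowsub (ord_alpha1 k3) Q = U1 *m M1 -> rowsub (ord_alpha2 k1) Q = U2 *m M2 ->
  [/\ exists M, Q = U *m M,
      exists C, rowsub (ord_alpha1 k3) U = U1 *m C &
      exists C, rowsub (ord_alpha2 k1) U = U2 *m C].
Proof.
case/andP; rewrite sub_capmx => /andP[/col_rangeP[N1 UN1] /col_rangeP[N2 UN2]] sub Q1 Q2.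
split.
- apply/col_rangeP/(submx_trans _ sub); rewrite sub_capmx; apply/andP.
  rewrite -[U1]vsubmxK mul_col_mx in Q1; rewrite -[U2]vsubmxK mul_col_mx in Q2.
  move: Q1 Q2; rewrite -[Q]vsubmxK -[usubmx Q]vsubmxK rowsub_alpha1 rowsub_alpha2.
  move=> /eq_col_mx[Ea Eb] /eq_col_mx[Ec Ed]; split; apply/col_rangeP.
    exists (col_mx M1 (dsubmx Q)); rewrite /col_mx3 !mul_col_mx !mul_row_col.
    by rewrite !mul0mx mul1mx add0r !addr0 Ea Eb.
  exists (col_mx (usubmx (usubmx Q)) M2); rewrite /col_mx3 !mul_col_mx !mul_row_col.
  by rewrite !mul0mx mul1mx !add0r addr0 Ec Ed.
- exists (usubmx N1); rewrite {1}UN1 -[N1 in LHS]vsubmxK rowsub_mul rowsub_alpha1.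
  by rewrite mul_col_mx !mul_row_col !mul0mx !addr0 -mul_col_mx vsubmxK.
exists (dsubmx N2); rewrite {1}UN2 -[N2 in LHS]vsubmxK rowsub_mul rowsub_alpha2.
by rewrite mul_col_mx !mul_row_col !mul0mx !add0r -mul_col_mx vsubmxK.
Qed.

Lemma alpha1P k1 k2 k3 (i : 'I_(k1 + k2 + k3)) :
  i \in alpha1 k1 k2 k3 -> exists j, i = ord_alpha1 k3 j.
Proof. by rewrite inE => lt_i; exists (Ordinal lt_i); apply: val_inj. Qed.

Lemma alpha2P k1 k2 k3 (i : 'I_(k1 + k2 + k3)) :
  i \in alpha2 k1 k2 k3 -> exists j, i = ord_alpha2 k1 j.
Proof.
rewrite inE => le_i; have lt_i : (i - k1 < k2 + k3)%N by rewrite ltn_subLR ?addnA.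
by exists (Ordinal lt_i); apply: val_inj; rewrite /= subnKC.
Qed.

Lemma const_on_union (R : realType) k1 k2 k3 (g : 'cV[R]_(k1 + k2 + k3)) c1 c2 :
  (0 < k2)%N -> rowsub (ord_alpha1 k3) g = const_mx c1 ->
  rowsub (ord_alpha2 k1) g = const_mx c2 -> g = c1 *: ones.
Proof.
move=> k20 /matrixP g1 /matrixP g2.
have e1 j : g (ord_alpha1 k3 j) 0 = c1 by have := g1 j 0; rewrite !mxE.
have e2 j : g (ord_alpha2 k1 j) 0 = c2 by have := g2 j 0; rewrite !mxE.
have c12 : c2 = c1.
  rewrite -(e1 (rshift k1 (Ordinal k20))) -(e2 (lshift k3 (Ordinal k20))).
  by congr (g _ 0); apply: val_inj.
apply/colP => i; rewrite !mxE mulr1; case: (ltnP i (k1 + k2)) => h.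
  have /alpha1P[j ->] : i \in alpha1 k1 k2 k3 by rewrite inE.
  exact: e1.
have /alpha2P[j ->] : i \in alpha2 k1 k2 k3 by rewrite inE (leq_trans (leq_addr _ _) h).
by rewrite e2.
Qed.

(** * Symmetric forms vanishing on two hyperplanes *)

Lemma sym_outer_eq0 (R : realType) t (a b : 'cV[R]_t) :
  a *m b^T + b *m a^T = 0 -> a != 0 -> b = 0.
Proof.
move=> e /cV0Pn [i ai].
have E j l : a j 0 * b l 0 + b j 0 * a l 0 = 0.
  by have /matrixP /(_ j l) := e; rewrite !mxE !big_ord1 !mxE.
have bi : b i 0 = 0.
  apply/eqP; have /eqP := E i i.
  by rewrite (mulrC (b i 0)) -mulr2n mulrn_eq0 /= mulf_eq0 (negPf ai).
apply/colP => j; rewrite [RHS]mxE; apply/eqP.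
by have /eqP := E i j; rewrite bi mul0r addr0 mulf_eq0 (negPf ai).
Qed.

(** Vanishing on the hyperplane orthogonal to n1 gives Dl = n1 w^T + w n1^T for
some w.  Compressing this to the hyperplane orthogonal to n2, where n1 is still
nonzero, forces the compression of w to vanish, so w is a multiple of n2. *)
Lemma sym_vanish_on_two_hyperplanes (R : realType) t (Dl : 'M[R]_t) (n1 n2 : 'cV[R]_t)
    (H1 := 1%:M - n1 *m n1^T) (H2 := 1%:M - n2 *m n2^T) :
  Dl^T = Dl -> n1^T *m n1 = 1%:M -> n2^T *m n2 = 1%:M -> H2 *m n1 != 0 ->
  H1 *m Dl *m H1^T = 0 -> H2 *m Dl *m H2^T = 0 ->
  exists tau, Dl = tau *: (n1 *m n2^T + n2 *m n1^T).
Proof.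
move=> sD n11 n22 n12 v1 v2.
pose b := (n1^T *m Dl *m n1) 0 0.
(* the correction by b / 2 splits the term b n1 n1^T evenly *)
pose w := Dl *m n1 - (b / 2) *: n1.
have bE : n1^T *m Dl *m n1 = b%:M by rewrite [LHS]mx11_scalar.
have DE : Dl = n1 *m w^T + w *m n1^T.
  have H1T : H1^T = H1 by rewrite /H1 linearB /= trmx1 trmx_mul trmxK.
  have e : H1 *m Dl *m H1 = Dl - n1 *m (Dl *m n1)^T - Dl *m n1 *m n1^T + b *: (n1 *m n1^T).
    rewrite /H1 mulmxBl mulmxBr mulmx1 mul1mx mulmxBl trmx_mul sD !mulmxA.
    rewrite -(mulmxA n1 n1^T) -(mulmxA n1 _ n1) bE mul_mx_scalar -scalemxAl.
    by rewrite opprB addrA addrAC.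
  apply/eqP; rewrite -subr_eq0 -v1 H1T e /w linearB /= linearZ /=.
  rewrite mulmxBr mulmxBl -scalemxAl -scalemxAr; apply/eqP.
  move: (n1 *m n1^T) (n1 *m (Dl *m n1)^T) (Dl *m n1 *m n1^T) => E1 E2 E3.
  by apply/matrixP => i j; rewrite !mxE; field.
have w2 : H2 *m w = 0.
  clearbody w H2; apply: (@sym_outer_eq0 _ _ (H2 *m n1)) => //; rewrite -v2 [in RHS]DE.
  by rewrite mulmxDr mulmxDl !trmx_mul !mulmxA.
have wE : w = (n2^T *m w) 0 0 *: n2.
  apply/eqP; rewrite -subr_eq0 -[X in _ == X]w2; apply/eqP.
  by rewrite mulmxBl mul1mx -mulmxA [in RHS](mx11_scalar (n2^T *m w)) mul_mx_scalar.
exists ((n2^T *m w) 0 0).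
by rewrite {1}DE {1 2}wE linearZ /= -scalemxAr -scalemxAl scalerDr.
Qed.

(** The row space of A is the hyperplane orthogonal to n, so the projection
onto that hyperplane factors through A. *)
Lemma vanish_on_hyperplane (R : realType) m r (A : 'M[R]_(m, r + 1)) (n : 'cV_(r + 1))
   (Dl : 'M_(r + 1)) :
  \rank A = r -> n^T *m n = 1%:M -> A *m n = 0 -> A *m Dl *m A^T = 0 ->
  (1%:M - n *m n^T) *m Dl *m (1%:M - n *m n^T)^T = 0.
Proof.
move=> rA nn An ADA.
have n0 := dot1_neq0 nn.
have Hn : (1%:M - n *m n^T) *m n = 0 by rewrite mulmxBl mul1mx -mulmxA nn mulmx1 subrr.
have /submxP[Y ->] := sub_rowspace_ker_line rA n0 An Hn.
by rewrite trmx_mul mulmxA -(mulmxA Y) -(mulmxA Y) ADA mulmx0 mul0mx.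
Qed.

(** * The singular pencil *)

Lemma outer_mul (R : realType) t (a b w : 'cV[R]_t) :
  a *m b^T *m w = (b^T *m w) 0 0 *: a.
Proof. by rewrite -mulmxA [b^T *m w]mx11_scalar mul_mx_scalar !mxE mulr1n. Qed.

Lemma dotC (R : realType) t (a b : 'cV[R]_t) : (a^T *m b) 0 0 = (b^T *m a) 0 0.
Proof. by rewrite -[in LHS](trmxK b) -trmx_mul mxE. Qed.

(** Let v span the kernel of X^T, and let a and b be the nonzero inner products
of v with n1 and n2.  For s != 0, pairing (X X^T + s dZ) w = 0 with v forces the
inner products of w with (n1, n2) to be c (-a, b) with c != 0.  Then
X X^T w = - s c (b n1 - a n2), and b n1 - a n2, being orthogonal to v, is X x for
some x.  Thus X^T w = - s c x; pairing with x gives - 2 a b c = - s c |x|^2, which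
determines s. *)
Lemma pencil_nonzero_root_unique (R : realType) r (X : 'M[R]_(r + 1, r)) (n1 n2 : 'cV[R]_(r + 1)) :
  row_full X ->
  (forall v : 'cV_(r + 1), v != 0 -> X^T *m v = 0 -> (n1^T *m v) 0 0 != 0) ->
  (forall v : 'cV_(r + 1), v != 0 -> X^T *m v = 0 -> (n2^T *m v) 0 0 != 0) ->
  exists s1, forall s (w : 'cV_(r + 1)), w != 0 ->
    (X *m X^T + s *: (n1 *m n2^T + n2 *m n1^T)) *m w = 0 -> s = 0 \/ s = s1.
Proof.
move=> fX nn1 nn2.
have rX : \rank X^T = r by rewrite mxrank_tr; exact/eqP.
have [v v0 Xv] := left_null_vector fX.
have a0 := nn1 _ v0 Xv; have b0 := nn2 _ v0 Xv.
set a := (n1^T *m v) 0 0 in a0; set b := (n2^T *m v) 0 0 in b0.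
pose mv := b *: n1 - a *: n2.
have mvT : mv^T = b *: n1^T - a *: n2^T by apply/matrixP => i j; rewrite !mxE.
have [x mx] : exists x, mv = X *m x.
  apply/col_rangeP/(sub_rowspace_ker_line rX v0 Xv).
  rewrite mvT mulmxBl -!scalemxAl.
  rewrite [n1^T *m v]mx11_scalar [n2^T *m v]mx11_scalar -/a -/b !scale_scalar_mx.
  by rewrite mulrC subrr.
exists (2 * a * b / (x^T *m x) 0 0) => s w w0 e.
have [->|s0] := eqVneq s 0; [by left|right].
set p := (n1^T *m w) 0 0; set q := (n2^T *m w) 0 0.
have E : X *m (X^T *m w) + s *: (q *: n1 + p *: n2) = 0.
  by rewrite -e mulmxDl -scalemxAl mulmxDl !outer_mul mulmxA.
have qa : q * a + p * b = 0.
  have vX : v^T *m X = 0 by rewrite -[v^T *m X]trmxK trmx_mul trmxK Xv trmx0.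
  have va : v^T *m n1 = a%:M by rewrite [LHS]mx11_scalar dotC.
  have vb : v^T *m n2 = b%:M by rewrite [LHS]mx11_scalar dotC.
  have /matrixP /(_ 0 0) := congr1 (mulmx v^T) E.
  rewrite mulmxDr (mulmxA v^T) vX mul0mx add0r mulmx0 -scalemxAr mulmxDr -!scalemxAr va vb.
  by rewrite !mxE !mulr1n => /eqP; rewrite mulf_eq0 (negPf s0) => /eqP.
pose c := q / b.
have qE : q = c * b by rewrite /c mulfVK.
have pE : p = - c * a.
  by apply: (mulIf b0); rewrite mulNr mulNr mulrAC -qE; apply/eqP; rewrite -addr_eq0 addrC qa.
have Xw : X^T *m w = - (s * c) *: x.
  apply/eqP; rewrite -subr_eq0 scaleNr opprK; apply/eqP/(row_full_eq0 fX).
  rewrite mulmxDr -scalemxAr -mx -E /mv qE pE; congr (_ + _).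
  by apply/matrixP => i j; rewrite !mxE; ring.
have c0 : c != 0.
  apply/eqP => c0; have := nn1 _ w0; rewrite Xw c0 mulr0 oppr0 scale0r => /(_ erefl).
  by rewrite -/p pE c0 oppr0 mul0r eqxx.
have key : s * (x^T *m x) 0 0 = 2 * a * b.
  apply: (mulfI c0).
  have : (mv^T *m w) 0 0 = - (s * c) * (x^T *m x) 0 0.
    by rewrite mx trmx_mul -mulmxA Xw -scalemxAr !mxE.
  have -> : (mv^T *m w) 0 0 = b * p - a * q.
    rewrite mvT mulmxBl -!scalemxAl [n1^T *m w]mx11_scalar [n2^T *m w]mx11_scalar.
    by rewrite -/p -/q !mxE !mulr1n.
  rewrite qE pE => h.
  have -> : c * (s * (x^T *m x) 0 0) = - (- (s * c) * (x^T *m x) 0 0) by ring.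
  by rewrite -h; ring.
rewrite -key mulfK //; apply: contraNneq (mulf_neq0 a0 b0) => h.
by apply/eqP; have := key; rewrite h mulr0; lra.
Qed.

Lemma det0_colP (F : fieldType) t (A : 'M[F]_t) :
  reflect (exists2 w : 'cV_t, w != 0 & A *m w = 0) (\det A == 0).
Proof.
rewrite -det_tr; apply: (iffP det0P) => -[w w0 e]; exists w^T; rewrite ?trmx_eq0 //.
  by rewrite -[A]trmxK -trmx_mul e trmx0.
by rewrite -trmx_mul e trmx0.
Qed.

(** Inverse of recip away from the excluded eigenvalue Some 0: the root s = 0 of
the pencil is the eigenvalue at infinity. *)
Definition eig_of_root (R : realType) (s : R) : option R :=
  if s == 0 then None else Some s^-1.

Lemma eig_of_rootK (R : realType) : cancel (@eig_of_root R) (@recip R).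
Proof. by move=> s; rewrite /eig_of_root; case: eqP => [->|_] //=; rewrite invrK. Qed.

Lemma recipK (R : realType) (tau : option R) :
  tau <> Some 0 -> eig_of_root (recip tau) = tau.
Proof.
case: tau => [x|_]; last by rewrite /eig_of_root eqxx.
by rewrite /eig_of_root /= invr_eq0 invrK; case: eqP => // ->.
Qed.

(** With s = 1 / tau, the equation - N w = tau Z w reads (Z + s N) w = 0; at
tau = oo both sides say Z w = 0. *)
Lemma gen_eigenvalue_root (R : realType) t (N Z : 'M[R]_t) tau :
  tau <> Some 0 ->
  gen_eigenvalue (- N) Z tau <-> \det (Z + recip tau *: N) == 0.
Proof.
move=> tau0; apply: iff_trans (rwP (det0_colP _)).
case: tau tau0 => [x|_] /=; last by rewrite scale0r addr0.
have [->|x0 _] := eqVneq x 0; first by [].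
split=> -[w w0 e]; exists w => //.
  apply: (scalerI x0); rewrite mulmxDl -scalemxAl scalerDr -e scalerA mulfV // scale1r.
  by rewrite mulNmx addNr scaler0.
move: e; rewrite mulmxDl -scalemxAl => /eqP; rewrite addr_eq0 => /eqP ->.
by rewrite scalerN scalerA mulfV // scale1r mulNmx.
Qed.

Unset Implicit Arguments.

(** * Completing the distance matrix *)

Theorem theorem2p14 (R : realType) (n r k1 k2 k3 : nat)
  (Hk : (k1 + k2 + k3 <= n)%N)
  (D : 'M[R]_n) (HD : EDM_embdim D r)
  (* D[alpha1 \cup alpha2], D[alpha1], D[alpha2] *)
  (Du := mxsub (widen_ord Hk) (widen_ord Hk) D)
  (D1 := mxsub (ord_alpha1 k3) (ord_alpha1 k3) Du)
  (D2 := mxsub (ord_alpha2 k1) (ord_alpha2 k1) Du)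
  (HD1 : EDM_embdim D1 r) (HD2 : EDM_embdim D2 r)
  (Ub1 : 'M[R]_(k1 + k2, r)) (Ub2 : 'M[R]_(k2 + k3, r)) (S1 S2 : 'M[R]_r)
  (HUb1 : Ub1^T *m Ub1 = 1%:M) (HUb2 : Ub2^T *m Ub2 = 1%:M)
  (HS1 : posdef S1) (HS2 : posdef S2)
  (HK1 : opKdag D1 = Ub1 *m S1 *m Ub1^T)
  (HK2 : opKdag D2 = Ub2 *m S2 *m Ub2^T)
  (U1 := extU Ub1) (U2 := extU Ub2)
  (U1' := usubmx U1) (U1'' := dsubmx U1)
  (U2'' := usubmx U2) (U2' := dsubmx U2)
  (Hrk1 : \rank U1'' = r) (Hrk2 : \rank U2'' = r)
  (Hrange : (U1''^T == U2''^T)%MS)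
  (u1 u2 : 'cV[R]_(r + 1))
  (Hu1 : u1 != 0) (Hu2 : u2 != 0)
  (HNu1 : U1'' *m u1 = 0) (HNu2 : U2'' *m u2 = 0)
  (Ub : 'M[R]_(k1 + k2 + k3, r + 1 + 1))
  (HUb : Ub^T *m Ub = 1%:M)
  (HUb_range1 :
    (Ub^T == (col_mx3 (row_mx U1' 0)
                      (row_mx U1'' 0)
                      (row_mx (U2' *m mpinv U2'' *m U1'') (U2' *m u2)))^T)%MS)
  (HUb_range2 :
    (Ub^T == (col_mx3 (row_mx (U1' *m mpinv U1'' *m U2'') (U1' *m u1))
                      (row_mx U2'' 0)
                      (row_mx U2' 0))^T)%MS)
  (HUb_range3 :
    (Ub^T == (col_mx3 (row_mx U1' 0) (row_mx U1'' 0) (row_mx 0 (1%:M : 'M_k3)))^T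
         :&: (col_mx3 (row_mx (1%:M : 'M_k1) 0) (row_mx 0 U2'') (row_mx 0 U2'))^T)%MS)
  (Vb : 'M[R]_(r + 1 + 1, r + 1))
  (W := row_mx Vb ((norm2 (Ub^T *m ones))^-1 *: (Ub^T *m ones)))
  (HW : W^T *m W = 1%:M)
  (beta delta1 delta2 : {set 'I_(k1 + k2 + k3)})
  (Hbeta : beta \subset alpha1 k1 k2 k3 :&: alpha2 k1 k2 k3)
  (Hbd1 : beta \proper delta1) (Hbd2 : beta \proper delta2)
  (Hd1 : delta1 \subset alpha1 k1 k2 k3) (Hd2 : delta2 \subset alpha2 k1 k2 k3)
  (A1 := centering *m rowsOf Ub delta1 *m Vb)
  (A2 := centering *m rowsOf Ub delta2 *m Vb)
  (B1 := opKdag (psub Du delta1)) (B2 := opKdag (psub Du delta2))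
  (Zb : 'M[R]_(r + 1)) (HZb : symm Zb)
  (HZb1 : A1 *m Zb *m A1^T = B1) (HZb2 : A2 *m Zb *m A2^T = B2)
  (Hdim1 : EDM_embdim (psub Du delta1) r)
  (Hdim2 : EDM_embdim (psub Du delta2) r)
  (Hr : (0 < r)%N) (Hdimb : EDM_embdim (psub Du beta) (r - 1)) :
  [/\ \rank (kermx A1^T) = 1%N, \rank (kermx A2^T) = 1%N &
    forall n1 n2 : 'cV[R]_(r + 1),
      A1 *m n1 = 0 -> norm2 n1 = 1 -> A2 *m n2 = 0 -> norm2 n2 = 1 ->
      let dZ := n1 *m n2^T + n2 *m n1^T in
      (forall Z : 'M[R]_(r + 1), symm Z ->
         (A1 *m Z *m A1^T = B1 /\ A2 *m Z *m A2^T = B2 <->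
          exists tau : R, Z = Zb + tau *: dZ)) /\
      (exists taus : seq (option R),
         [/\ (size taus <= 2)%N,
             forall tau, tau \in taus <->
               tau <> Some 0 /\ gen_eigenvalue (- dZ) Zb tau &
             exists2 tau, tau \in taus &
               Du = opK (Ub *m Vb *m (Zb + recip tau *: dZ)
                           *m Vb^T *m Ub^T)])].
Proof.
have [/EDM_gram[P0 DP] _] := HD.
pose P := rowsub (widen_ord Hk) P0.
have DuP : Du = opK (P *m P^T) by rewrite /Du DP mxsub_opK.
have k20 : (0 < k2)%N by apply: leq_trans Hr _; rewrite -Hrk1 rank_leq_row.
pose Q := row_mx P ones.
have [M1 uM1 QM1] : exists2 M, M \in unitmx & rowsub (ord_alpha1 k3) Q = U1 *m M.
  rewrite /Q rowsub_row_mx rowsub_ones.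
  have D1P : D1 = opK (rowsub (ord_alpha1 k3) P *m (rowsub (ord_alpha1 k3) P)^T).
    by rewrite /D1 DuP mxsub_opK.
  rewrite D1P in HD1 HK1; apply: extU_affine_range HUb1 HK1.
    by rewrite addn_gt0 k20 orbT.
  exact: embdim_row_full.
have [M2 uM2 QM2] : exists2 M, M \in unitmx & rowsub (ord_alpha2 k1) Q = U2 *m M.
  rewrite /Q rowsub_row_mx rowsub_ones.
  have D2P : D2 = opK (rowsub (ord_alpha2 k1) P *m (rowsub (ord_alpha2 k1) P)^T).
    by rewrite /D2 DuP mxsub_opK.
  rewrite D2P in HD2 HK2; apply: extU_affine_range HUb2 HK2.
    by rewrite addn_gt0 k20.
  exact: embdim_row_full.
(* the range of Ub contains the affine functions of the points, and its
   elements are affine on each clique *)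
have [[M QM] [C1 UC1] [C2 UC2]] := overlap_range HUb_range3 QM1 QM2.
have aff1 : rowsub (ord_alpha1 k3) Ub = rowsub (ord_alpha1 k3) Q *m (invmx M1 *m C1).
  by rewrite QM1 -mulmxA mulKVmx.
have aff2 : rowsub (ord_alpha2 k1) Ub = rowsub (ord_alpha2 k1) Q *m (invmx M2 *m C2).
  by rewrite QM2 -mulmxA mulKVmx.
have [PM onesM] : P = Ub *m lsubmx M /\ ones = Ub *m rsubmx M.
  by apply: eq_row_mx; rewrite -mul_mx_row hsubmxK.
pose s := (norm2 (Ub^T *m ones))^-1; pose w := s *: (Ub^T *m ones).
have {}HW : (row_mx Vb w)^T *m row_mx Vb w = 1%:M := HW.
(* ones lies in the range of Ub, on which Ub Ub^T is the identity *)
have Uw : Ub *m w = s *: ones.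
  by rewrite /w -scalemxAr [in LHS]onesM (mulmxA Ub^T) HUb mul1mx -onesM.
have WW : Vb *m Vb^T + w *m w^T = 1%:M.
  by rewrite -mul_row_col -tr_row_mx; apply: mulmx1C.
have [VV Vw ww] : [/\ Vb^T *m Vb = 1%:M, Vb^T *m w = 0 & w^T *m w = 1%:M].
  move: HW; rewrite tr_row_mx mul_col_row scalar_mx_block.
  by case/eq_block_mx.
(* splitting the coordinates of the points along Vb and w, the part along w
   is a translation *)
pose X := Vb^T *m lsubmx M; pose c := s *: (w^T *m lsubmx M).
have PX : P = Ub *m Vb *m X + ones *m c.
  rewrite {1}PM -[lsubmx M]mul1mx -WW mulmxDl mulmxDr !mulmxA Uw /X /c.
  by rewrite -scalemxAr -!scalemxAl ?mulmxA.
have in1 i : i \in delta1 -> exists j, i = ord_alpha1 k3 j.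
  by move/(subsetP Hd1); exact: alpha1P.
have in2 i : i \in delta2 -> exists j, i = ord_alpha2 k1 j.
  by move/(subsetP Hd2); exact: alpha2P.
have Dd (d : {set 'I_(k1 + k2 + k3)}) : psub Du d = opK (rowsOf P d *m (rowsOf P d)^T).
  by rewrite /psub DuP mxsub_opK.
rewrite Dd in Hdim1; rewrite Dd in Hdim2.
have full1 := embdim_row_full Hdim1; have full2 := embdim_row_full Hdim2.
have rA1 : \rank A1 = r := rank_centered aff1 in1 full1 PX.
have rA2 : \rank A2 = r := rank_centered aff2 in2 full2 PX.
have AX1 : A1 *m X = _ := centered_factor delta1 PX.
have AX2 : A2 *m X = _ := centered_factor delta2 PX.
pose Z0 := X *m X^T.
have Z01 : A1 *m Z0 *m A1^T = B1.
  by rewrite /Z0 mulmxA AX1 -mulmxA -trmx_mul AX1 /B1 Dd opKdag_opK.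
have Z02 : A2 *m Z0 *m A2^T = B2.
  by rewrite /Z0 mulmxA AX2 -mulmxA -trmx_mul AX2 /B2 Dd opKdag_opK.
have fX : row_full X.
  apply: inj_row_full => x Xx; apply: (row_full_eq0 full1).
  by rewrite -AX1 -mulmxA Xx mulmx0.
(* a function in the kernel of both is constant on both cliques, which share
   a point; but Vb n' has no component along w, the coordinates of constants *)
have trivial_ker (n' : 'cV[R]_(r + 1)) : A1 *m n' = 0 -> A2 *m n' = 0 -> n' = 0.
  move=> An1 An2.
  have [c1 e1] := ker_centered_const aff1 in1 full1 An1.
  have [c2 e2] := ker_centered_const aff2 in2 full2 An2.
  have := const_on_union k20 e1 e2.
  have s0 : s != 0.
    by apply: contraNneq (dot1_neq0 ww) => s0; rewrite /w s0 scale0r.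
  have -> : ones = Ub *m (s^-1 *: w) by rewrite -scalemxAr Uw scalerA mulVf // scale1r.
  move/(congr1 (mulmx (Vb^T *m Ub^T))).
  rewrite -(mulmxA Vb^T) -(mulmxA Ub) (mulmxA Ub^T) HUb mul1mx (mulmxA Vb^T) VV mul1mx => ->.
  by rewrite -scalemxAr -(mulmxA Vb^T) (mulmxA Ub^T) HUb mul1mx -scalemxAr Vw !scaler0.
split; rewrite ?mxrank_ker ?mxrank_tr ?rA1 ?rA2 ?addKn // => n1 n2 An1 n11 An2 n22 dZ.
have {}n11 : n1^T *m n1 = 1%:M by rewrite dot_selfE n11 expr1n.
have {}n22 : n2^T *m n2 = 1%:M by rewrite dot_selfE n22 expr1n.
have indep : (1%:M - n2 *m n2^T) *m n1 != 0.
  apply: contraNneq (dot1_neq0 n11) => /eqP.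
  rewrite mulmxBl mul1mx outer_mul subr_eq0 => /eqP e.
  by apply/eqP/trivial_ker => //; rewrite e -scalemxAr An2 scaler0.
have solZ Z : symm Z ->
    (A1 *m Z *m A1^T = B1 /\ A2 *m Z *m A2^T = B2 <-> exists tau : R, Z = Zb + tau *: dZ).
  move=> sZ; split=> [[Z1 Z2]|[tau ->]]; last first.
    have dZ0 (m : nat) (A : 'M[R]_(m, r + 1)) : A *m n1 = 0 \/ A *m n2 = 0 -> A *m dZ *m A^T = 0.
      rewrite /dZ mulmxDr mulmxDl !mulmxA => -[] e.
        by rewrite e !mul0mx add0r -mulmxA -trmx_mul e trmx0 mulmx0.
      by rewrite e !mul0mx addr0 -mulmxA -trmx_mul e trmx0 mulmx0.
    split; rewrite mulmxDr mulmxDl -scalemxAr -scalemxAl dZ0 ?scaler0 ?addr0 //.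
      by left.
    by right.
  suff [tau e] : exists tau, Z - Zb = tau *: dZ by exists tau; rewrite -e addrC subrK.
  apply: sym_vanish_on_two_hyperplanes => //.
  - by rewrite linearB /= sZ HZb.
  - apply: vanish_on_hyperplane rA1 n11 An1 _.
    by rewrite mulmxBr mulmxBl Z1 HZb1 subrr.
  - apply: vanish_on_hyperplane rA2 n22 An2 _.
    by rewrite mulmxBr mulmxBl Z2 HZb2 subrr.
split=> //.
(* the true configuration is one of the solutions *)
have [tau0 Z0E] : exists tau, Z0 = Zb + tau *: dZ.
  by apply/solZ => //; rewrite /symm /Z0 trmx_mul trmxK.
(* otherwise n' would be in the range of X, on which A is injective *)
have transverse (m : nat) (A : 'M[R]_(m, r + 1)) (n' v : 'cV_(r + 1)) :
    row_full (A *m X) -> n' != 0 -> A *m n' = 0 -> v != 0 -> X^T *m v = 0 -> (n'^T *m v) 0 0 != 0.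
  move=> fAX n0 An v0 Xv; apply: contraNneq n0 => nv.
  have nv0 : n'^T *m v = 0 by rewrite [LHS]mx11_scalar nv raddf0.
  have rX : \rank X^T = r by rewrite mxrank_tr; exact/eqP.
  have /col_rangeP[x nx] := sub_rowspace_ker_line rX v0 Xv nv0.
  have /(row_full_eq0 fAX) x0 : A *m X *m x = 0 by rewrite -mulmxA -nx.
  by rewrite nx x0 mulmx0.
have [s1 s1P] : exists s1, forall s' (u : 'cV_(r + 1)), u != 0 ->
    (X *m X^T + s' *: dZ) *m u = 0 -> s' = 0 \/ s' = s1.
  apply: pencil_nonzero_root_unique => // v v0 Xv.
    by apply: (transverse _ A1) => //; rewrite ?AX1 // dot1_neq0.
  by apply: (transverse _ A2) => //; rewrite ?AX2 // dot1_neq0.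
(* tau0 + s1 may fail to be a root, and is then discarded by the filter *)
pose roots := [seq t <- [:: tau0; tau0 + s1] | \det (Zb + t *: dZ) == 0].
have rootsP t : (t \in roots) = (\det (Zb + t *: dZ) == 0).
  rewrite mem_filter; apply: andb_idr => /det0_colP[u u0 e].
  have {}e : (X *m X^T + (t - tau0) *: dZ) *m u = 0.
    by rewrite -/Z0 Z0E -addrA -scalerDl subrKC.
  rewrite !inE; case: (s1P _ _ u0 e) => /eqP; first by rewrite subr_eq0 => ->.
  by rewrite subr_eq addrC => ->; rewrite orbT.
exists (map (@eig_of_root R) roots); split.
- by rewrite size_map size_filter (leq_trans (count_size _ _)).
- move=> tau; split=> [/mapP[t tr ->]|[tau_n0 /(gen_eigenvalue_root _ _ tau_n0)]].
    have t0 : eig_of_root t <> Some 0.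
      by rewrite /eig_of_root; case: eqP => // /eqP t0 [] /eqP; rewrite invr_eq0 (negPf t0).
    split=> //; apply/gen_eigenvalue_root => //.
    by rewrite eig_of_rootK -rootsP.
  by rewrite -rootsP => tr; rewrite -(recipK tau_n0) map_f.
exists (eig_of_root tau0).
  (* Z0 is singular since X has one more row than columns *)
  apply: map_f; rewrite rootsP -Z0E; have [v v0 Xv] := left_null_vector fX.
  by apply/det0_colP; exists v; rewrite // /Z0 -mulmxA Xv mulmx0.
rewrite eig_of_rootK -Z0E DuP PX opK_gram_translate /Z0.
by rewrite [in RHS]mulmxA -[in RHS](mulmxA _ Vb^T) -[in RHS](mulmxA _ X^T) -!trmx_mul !mulmxA.
Qed.
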